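(* For each integer $k>0$ consider the vector field $$X_k:=(w^{k+1}+izw^k)\frac{\partial}{\partial z}+w^{k+2}\frac{\partial}{\partial w}$$ on $(\mathbb C^2,0)$. Then any formal invertible transformation of $(\mathbb C^2,0)$ bringing $X_k$ to a normal form $$izw^{k}(1+ c_1w+\dots+ c_{q}w^{q})\frac{\partial}{\partial z}+(r w^{k+1+q}+tw^{2q+2k+1})\frac{\partial}{\partial w}$$ (with an integer $q\ge1$ and constants $c_1,\dots,c_q,r,t$) is divergent.
   Context: A formal invertible transformation of $(\mathbb C^2,0)$ is a pair of formal power series in $(z,w)$ without constant term and with invertible linear part; it is divergent if it does not converge in any neighborhood of the origin. *)

(* Defs.v *)
From mathcomp Require Import all_boot all_order all_algebra.
From mathcomp Require Import all_classical all_reals all_analysis.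
From mathcomp Require Import complex.

Set Implicit Arguments.
Unset Strict Implicit.
Unset Printing Implicit Defensive.

Import Order.TTheory GRing.Theory Num.Theory.

Local Open Scope classical_set_scope.
Local Open Scope ring_scope.

(* A formal power series in (z, w): f m n is the coefficient of z^m w^n.
   Addition is the pointwise addition of functions; the product of series is
   [ps_mul], not the pointwise product. *)
Notation series2 K := (nat -> nat -> K).

Section FormalSeries.
Context {K : comNzRingType}.
Implicit Types (f g : series2 K) (phi X : series2 K * series2 K).

Definition ps_mono (a : K) (p q : nat) : series2 K :=
  fun m n => if (m == p) && (n == q) then a else 0.

Definition ps_mul f g : series2 K :=
  fun m n => \sum_(i < m.+1) \sum_(j < n.+1) f i j * g (m - i)%N (n - j)%N.

Definition ps_exp f (e : nat) : series2 K := iter e (ps_mul f) (ps_mono 1 0 0).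

Definition ps_dz f : series2 K := fun m n => f m.+1 n *+ m.+1.
Definition ps_dw f : series2 K := fun m n => f m n.+1 *+ n.+1.

(* f \o phi, for phi without constant term: phi.1^i phi.2^j has no term of
   total degree < i + j, so the coefficient of z^m w^n in the composite only
   involves the f i j with i + j <= m + n, and the sums below contain all of
   those. *)
Definition ps_comp f phi : series2 K :=
  fun m n => \sum_(i < (m + n).+1) \sum_(j < (m + n).+1)
    f i j * ps_mul (ps_exp phi.1 i) (ps_exp phi.2 j) m n.

(* A vector field X.1 d/dz + X.2 d/dw, acting as a derivation. *)
Definition vf_apply X f : series2 K :=
  ps_mul X.1 (ps_dz f) + ps_mul X.2 (ps_dw f).

Definition linear_part phi : 'M[K]_2 :=
  \matrix_(i < 2, j < 2)
    let f := if i == 0 then phi.1 else phi.2 in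
    if j == 0 then f 1%N 0%N else f 0%N 1%N.

End FormalSeries.

Definition formal_transformation {K : comUnitRingType}
    (phi : series2 K * series2 K) : Prop :=
  [/\ phi.1 0%N 0%N = 0, phi.2 0%N 0%N = 0 & linear_part phi \in unitmx].

(* In the new coordinates (z', w') = phi (z, w), the field X reads Y, i.e.
   D phi . X = Y \o phi. *)
Definition brings_to {K : comNzRingType} (phi X Y : series2 K * series2 K) : Prop :=
  vf_apply X phi.1 = ps_comp Y.1 phi /\ vf_apply X phi.2 = ps_comp Y.2 phi.

Section Convergence.
Context {R : realType}.

(* Convergence of a double series is unconditional, i.e. absolute. *)
Definition ps_converges_at (f : series2 R[i]) (z w : R[i]) : Prop :=
  summable [set: nat * nat]
    (fun p => (Normc.normc (f p.1 p.2 * z ^+ p.1 * w ^+ p.2))%:E).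

Definition ps_convergent (f : series2 R[i]) : Prop :=
  exists2 rho : R, 0 < rho &
    forall z w : R[i], Normc.normc z < rho -> Normc.normc w < rho ->
      ps_converges_at f z w.

Definition divergent (phi : series2 R[i] * series2 R[i]) : Prop :=
  ~ (ps_convergent phi.1 /\ ps_convergent phi.2).

(* (w^(k+1) + i z w^k) d/dz + w^(k+2) d/dw *)
Definition X_field (k : nat) : series2 R[i] * series2 R[i] :=
  (ps_mono 1 0 k.+1 + ps_mono 'i%C 1 k, ps_mono 1 0 k.+2).

(* i z w^k (1 + c_1 w + ... + c_q w^q) d/dz
   + (r w^(k+1+q) + t w^(2q+2k+1)) d/dw, where c_(j+1) is c j. *)
Definition normal_form (k q : nat) (c : 'I_q -> R[i]) (r t : R[i]) :
    series2 R[i] * series2 R[i] :=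
  (ps_mul (ps_mono 'i%C 1 k)
     (ps_mono 1 0 0 + \sum_(j < q) ps_mono (c j) 0 j.+1),
   ps_mono r 0 (k + 1 + q)%N + ps_mono t 0 (2 * q + 2 * k + 1)%N).

End Convergence.

(* Main.v *)
(* The field [X_k] is [w^k] times the saddle-node [(w + i z) d/dz + w^2 d/dw], whose
   formal center manifold [z = s(w)], [w^2 s' = w + i s], has coefficients of modulus
   [|s_n| = (n - 1)!].  Since the normal form is tangent to [z = 0], the function
   [F(w) = f(s(w), w)], with [f] the first component of the transformation, satisfies
   [w^(k+2) F' = F H] where [H = i b^k w^k + ...] with [b <> 0]; comparing leading terms,
   [F = 0].  The curve [f = 0] being thus the center manifold, [f] cannot converge: in
   [f(s(w), w) = 0] the coefficient [f 1 0 * s_n] would dominate all the others. *)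
Require Import Defs.
From mathcomp Require Import all_boot all_order all_algebra.
From mathcomp Require Import all_classical all_reals all_analysis.
From mathcomp Require Import complex.
From mathcomp Require Import ring zify.

Set Implicit Arguments.
Unset Strict Implicit.
Unset Printing Implicit Defensive.

Import Order.TTheory GRing.Theory Num.Theory.

Local Open Scope ring_scope.

Lemma sum_ord_widen0 (V : nmodType) n N (F : nat -> V) : (n <= N)%N ->
  (forall i, (n <= i < N)%N -> F i = 0) -> \sum_(i < N) F i = \sum_(i < n) F i.
Proof.
move=> nN F0; rewrite (big_ord_widen _ _ nN) [LHS](bigID (fun i : 'I_N => i < n)%N) /=.
by rewrite [X in _ + X]big1 ?addr0 // => i; rewrite -leqNgt => ni; rewrite F0 ?ni /=.
Qed.

(** * Polynomial truncations of double power series *)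

Section Approximation.
Context {K : comNzRingType}.
Implicit Types (f g h : series2 K) (P Q : {poly {poly K}}) (S : {poly K}).

Lemma series2_addE f g m n : (f + g) m n = f m n + g m n.
Proof. by []. Qed.

Lemma ps_mulDl f g h m n :
  ps_mul (f + g) h m n = ps_mul f h m n + ps_mul g h m n.
Proof.
rewrite /ps_mul -big_split; apply: eq_bigr => i _.
by rewrite -big_split; apply: eq_bigr => j _; rewrite mulrDl.
Qed.

Lemma ps_mul_mono (a : K) p q h m n :
  ps_mul (ps_mono a p q) h m n =
    if (p <= m)%N && (q <= n)%N then a * h (m - p)%N (n - q)%N else 0.
Proof.
rewrite /ps_mul /ps_mono; have [pm|mp] := leqP p m; last first.
  by apply: big1 => i _; apply: big1 => j _; rewrite ltn_eqF ?mul0r //; have := ltn_ord i; lia.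
rewrite (bigD1 (Ordinal (pm : p < m.+1)%N)) //= [X in _ + X]big1 => [|i ip]; last first.
  by apply: big1 => j _; rewrite -val_eqE /= in ip; rewrite (negPf ip) mul0r.
rewrite addr0; have [qn|nq] := leqP q n; last first.
  by apply: big1 => j _; rewrite andbC ltn_eqF ?mul0r //; have := ltn_ord j; lia.
rewrite (bigD1 (Ordinal (qn : q < n.+1)%N)) //= [X in _ + X]big1 => [|j jq]; last first.
  by rewrite -val_eqE /= in jq; rewrite (negPf jq) andbF mul0r.
by rewrite addr0 !eqxx.
Qed.

(** The outer variable of [P] stands for [z] and the inner one for [w], so that [P.[S]] is the
    restriction [P(S(w), w)] to the curve [z = S(w)]. Composition and differentiation of series
    thereby become exact polynomial operations. *)
Definition approx (N : nat) P f :=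
  forall m n, (m + n < N)%N -> P`_m`_n = f m n.

Definition truncation (N : nat) f : {poly {poly K}} :=
  \sum_(p < N) \sum_(m < p.+1) (f m (p - m)%N *: 'X^(p - m))%:P * 'X^m.

Lemma approx_truncation N f : approx N (truncation N f) f.
Proof.
move=> m n mnN; rewrite !coef_sum.
rewrite (bigD1 (Ordinal mnN)) //= !coef_sum [X in _ + X]big1 => [|p pmn]; last first.
  rewrite !coef_sum; apply: big1 => i _.
  rewrite coefCM coefXn; case: eqP => [mi|]; last by rewrite mulr0 coef0.
  rewrite mulr1 coefZ coefXn; case: eqP => [nE|]; last by rewrite mulr0.
  case/eqP: pmn; apply/val_inj => /=; rewrite mi nE subnKC //.
  by rewrite -ltnS.
have mp : (m < (m + n).+1)%N by rewrite ltnS leq_addr.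
rewrite addr0 (bigD1 (Ordinal mp)) //= big1 => [|i im].
  by rewrite addr0 addKn coefCM coefXn eqxx mulr1 coefZ coefXn eqxx mulr1.
rewrite coefCM coefXn; case: eqP => [mi|]; last by rewrite mulr0 coef0.
by case/eqP: im; apply/val_inj.
Qed.

Lemma approxW M N P f : (M <= N)%N -> approx N P f -> approx M P f.
Proof. by move=> MN Pf m n mn; apply: Pf; apply: leq_trans MN. Qed.

Lemma approxD N P Q f g : approx N P f -> approx N Q g -> approx N (P + Q) (f + g).
Proof. by move=> Pf Qg m n mn; rewrite !coefD Pf // Qg. Qed.

Lemma approxM N P Q f g :
  approx N P f -> approx N Q g -> approx N (P * Q) (ps_mul f g).
Proof.
move=> Pf Qg m n mn; rewrite coefM coef_sum; apply: eq_bigr => i _.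
rewrite coefM; apply: eq_bigr => j _.
have := ltn_ord i; have := ltn_ord j; rewrite !ltnS => jn im.
by rewrite Pf ?Qg //; lia.
Qed.

Lemma approx_mono N a p q : approx N ((a *: 'X^q)%:P * 'X^p) (ps_mono a p q).
Proof.
move=> m n _; rewrite coefCM coefXn /ps_mono.
by case: eqP => _ /=; rewrite ?mulr0 ?coef0 // mulr1 coefZ coefXn; case: eqP;
  rewrite ?mulr1 ?mulr0.
Qed.

Lemma approxX N P f e : approx N P f -> approx N (P ^+ e) (ps_exp f e).
Proof.
move=> Pf; elim: e => [|e IH]; last by rewrite exprS; apply: approxM.
by have := @approx_mono N 1 0 0; rewrite scale1r !expr0 mulr1 polyC1.
Qed.

Lemma approx_dz N P f : approx N.+1 P f -> approx N P^`() (ps_dz f).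
Proof. by move=> Pf m n mn; rewrite coef_deriv coefMn Pf. Qed.

Lemma approx_dw N P f : approx N.+1 P f -> approx N (map_poly (@deriv K) P) (ps_dw f).
Proof.
by move=> Pf m n mn; rewrite coef_map coef_deriv Pf // addnS.
Qed.

Definition order_ge (a : nat) f := forall m n, (m + n < a)%N -> f m n = 0.

Lemma order_geM a b f g :
  order_ge a f -> order_ge b g -> order_ge (a + b) (ps_mul f g).
Proof.
move=> fa gb m n mn; apply: big1 => i _; apply: big1 => j _.
have := ltn_ord i; have := ltn_ord j; rewrite !ltnS => jn im.
have [ija|aij] := ltnP (i + j) a; first by rewrite fa // mul0r.
by rewrite gb ?mulr0 //; lia.
Qed.

Lemma order_geX f e : f 0%N 0%N = 0 -> order_ge e (ps_exp f e).
Proof.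
move=> f0; elim: e => [//|e IH]; rewrite -add1n; apply: order_geM => //.
by move=> [|m] [|n].
Qed.

(** Since [phi] has no constant term, [phi.1^i phi.2^j] has order at least [i + j]. Hence cutting
    both sums at [N], or at [(m + n).+1] as [ps_comp] does, gives the same coefficients below total
    degree [N]. *)
Lemma approx_comp N P Q (phi : series2 K * series2 K) (Y : series2 K) :
  phi.1 0%N 0%N = 0 -> phi.2 0%N 0%N = 0 ->
  approx N P phi.1 -> approx N Q phi.2 ->
  approx N (\sum_(i < N) \sum_(j < N) (Y i j)%:P%:P * (P ^+ i * Q ^+ j))
    (ps_comp Y phi).
Proof.
move=> phi1 phi2 Pf Qg m n mn.
have vanish i j : ((m + n).+1 <= i + j)%N ->
    ps_mul (ps_exp phi.1 i) (ps_exp phi.2 j) m n = 0.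
  by move=> ij; apply: (order_geM (order_geX (e := i) phi1) (order_geX (e := j) phi2) ij).
rewrite !coef_sum /ps_comp; pose v i j := ps_mul (ps_exp phi.1 i) (ps_exp phi.2 j) m n.
transitivity (\sum_(i < N) \sum_(j < N) Y i j * v i j).
  apply: eq_bigr => i _; rewrite !coef_sum; apply: eq_bigr => j _.
  by rewrite !coefCM (approxM (approxX i Pf) (approxX j Qg)).
rewrite (@sum_ord_widen0 _ (m + n).+1 N (fun i => \sum_(j < N) Y i j * v i j)) //.
  apply: eq_bigr => i _; rewrite (@sum_ord_widen0 _ (m + n).+1 N (fun j => Y i j * v i j)) //.
  by move=> j /andP[jmn _]; rewrite /v vanish ?mulr0 // (leq_trans jmn) // leq_addl.
move=> i /andP[imn _]; apply: big1 => j _.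
by rewrite /v vanish ?mulr0 // (leq_trans imn) // leq_addr.
Qed.

Lemma poly_eqMX S : S`_0 = 0 -> {T : {poly K} | S = T * 'X}.
Proof.
move=> S0; exists (drop_poly 1 S).
rewrite -[LHS](poly_take_drop 1) expr1 [X in X + _](_ : _ = 0) ?add0r //.
by apply/polyP => i; rewrite coef_take_poly coef0; case: i.
Qed.

(** As [S] is divisible by [w], a monomial [z^m w^n] restricts to order at least [m + n]; the
    coefficient of [w^d] only sees total degrees up to [d]. *)
Lemma approx_horner N P Q f S d : S`_0 = 0 -> approx N P f -> approx N Q f ->
  (d < N)%N -> P.[S]`_d = Q.[S]`_d.
Proof.
move=> S0 Pf Qf dN; apply/eqP; rewrite -subr_eq0 -coefB -hornerN -hornerD.
have [T ->] := poly_eqMX S0.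
rewrite horner_coef coef_sum big1 // => i _.
rewrite exprMn mulrA coefMXn; case: ltnP => // id.
rewrite coefM big1 // => j _.
have := ltn_ord j; rewrite ltnS => jd.
by rewrite !coefB Pf ?Qf ?subrr ?mul0r //; lia.
Qed.

(** Chain rule for [P(S(w), w)]. *)
Lemma deriv_horner P S :
  (P.[S])^`() = (map_poly (@deriv K) P).[S] + (P^`()).[S] * S^`().
Proof.
elim/poly_ind: P => [|P c IH]; first by rewrite map_poly0 linear0 !horner0 linear0 mul0r addr0.
have -> : map_poly (@deriv K) (P * 'X + c%:P) = map_poly (@deriv K) P * 'X + (c^`())%:P.
  apply/polyP => i; rewrite coef_map !coefD !coefMX !coefC.
  by rewrite /= derivD; case: (i == 0%N); rewrite /= ?coef_map ?derivC ?linear0.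
by rewrite derivMXaddC !hornerE derivD derivM IH; ring.
Qed.

End Approximation.

(** Strong induction on [d], comparing coefficients in degree [d + k]. The right side reduces to
    [F_d H_k], while the left side is [(d - 1) F_(d-1)] or zero, hence vanishes by induction. *)
Lemma leading_coef_ode_eq0 (K : idomainType) k N (F H : {poly K}) :
    (forall e, (e < N)%N -> ('X^(k.+2) * F^`())`_e = (F * H)`_e) ->
    (forall j, (j < k)%N -> H`_j = 0) -> H`_k != 0 ->
  forall d, (d + k < N)%N -> F`_d = 0.
Proof.
move=> ode Hlt Hk; elim/ltn_ind => d IH dkN.
have := ode _ dkN; have dlt : (d < (d + k).+1)%N by rewrite ltnS leq_addr.
rewrite coefXnM coefM (bigD1 (Ordinal dlt)) //= big1 => [|i]; last first.
  rewrite -val_eqE /= => id; have := ltn_ord i => ilt.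
  have [lt_id|le_di] := ltnP i d; first by rewrite IH ?mul0r //; lia.
  by rewrite Hlt ?mulr0 //; lia.
rewrite addKn addr0; case: ltnP => [_|le2].
  by move/esym/eqP; rewrite mulf_eq0 (negPf Hk) orbF => /eqP.
have -> : (d + k - k.+2 = d.-2)%N by lia.
rewrite coef_deriv (_ : d.-2.+1 = d.-1); last by lia.
rewrite IH ?mul0rn; [|lia..].
by move/esym/eqP; rewrite mulf_eq0 (negPf Hk) orbF => /eqP.
Qed.

(** * The formal center manifold and the equation along it *)

Section CenterManifold.
Context {K : idomainType} (I : K).
Hypothesis I2 : I ^+ 2 = -1.

(* The Taylor coefficients of the formal solution [z = s(w)] of [w^2 s' = w + I s]. *)
Definition center_coef (n : nat) : K :=
  if n is n'.+1 then I * (- I) ^+ n' * n'`!%:R else 0.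

Definition center_poly (N : nat) : {poly K} := \poly_(i < N) center_coef i.

Lemma center_poly0 N : (center_poly N)`_0 = 0.
Proof. by rewrite coef_poly; case: ifP. Qed.

Lemma center_poly_ode N e : (e < N)%N ->
  ('X + I *: center_poly N - 'X^2 * (center_poly N)^`())`_e = 0.
Proof.
move=> eN; rewrite coefB coefD coefX coefZ coefXnM coef_deriv !coef_poly eN.
case: e eN => [|[|e]] eN /=.
- by rewrite mulr0 addr0 subr0.
- by rewrite expr0 !mulr1 -expr2 I2 subrr subr0.
rewrite !subSS subn0 ltnW // add0r exprS factS natrM.
ring: I2.
Qed.

Lemma coef_series_leading k N (a : nat -> K) (G : {poly K}) : (k < N)%N ->
    G`_0 = 0 -> (forall j, (j < k)%N -> a j = 0) ->
  forall j, (j <= k)%N ->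
  (\sum_(l < N) a l *: G ^+ l)`_j = if j == k then a k * G`_1 ^+ k else 0.
Proof.
move=> kN G0 a0 j jk; have [T ->] := poly_eqMX G0; rewrite coefMX /=.
rewrite coef_sum (bigD1 (Ordinal kN)) //= big1 => [|l lk].
  rewrite coefZ exprMn coefMXn addr0; case: ltngtP jk => //; rewrite ?mulr0 //.
  by move=> -> _; rewrite subnn -!horner_coef0 horner_exp.
rewrite coefZ exprMn coefMXn; have [lt_lk|le_kl] := ltnP l k; first by rewrite a0 // mul0r.
have -> : (j < l)%N by rewrite (leq_ltn_trans jk) // ltn_neqAle le_kl eq_sym andbT.
by rewrite mulr0.
Qed.

(** The hypotheses on [Y] make it [z] times a series in [w] of order [k], so [Y] composed with [phi]
    is [phi.1] times a series in [phi.2]. Restricted to the center manifold, the conjugacy equation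
    becomes the linear equation of [leading_coef_ode_eq0]. The truncation is taken at [N.+1] because
    differentiation loses one degree. *)
Lemma invariant_on_center k (phi : series2 K * series2 K) (Y : series2 K) :
    (0 < k)%N -> phi.1 0%N 0%N = 0 -> phi.2 0%N 0%N = 0 -> phi.2 1%N 0%N = 0 ->
    phi.2 0%N 1%N != 0 ->
    (forall i j, i != 1%N -> Y i j = 0) ->
    (forall j, (j < k)%N -> Y 1%N j = 0) -> Y 1%N k != 0 ->
    vf_apply (ps_mono 1 0 k.+1 + ps_mono I 1 k, ps_mono 1 0 k.+2) phi.1 = ps_comp Y phi ->
  forall N d, (d + k < N)%N -> (truncation N.+1 phi.1).[center_poly N]`_d = 0.
Proof.
move=> k0 phi1 phi2 phi210 phi201 Yn1 Ylt Yk HY N.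
have [leNk|kN] := leqP N k.
  by move=> d; rewrite ltnNge (leq_trans leNk) ?leq_addl.
have N1 : (1 < N)%N by lia.
set P := truncation N.+1 phi.1; pose Q := truncation N.+1 phi.2; set S := center_poly N.
have S0 : S`_0 = 0 by exact: center_poly0.
have PN : approx N.+1 P phi.1 by exact: approx_truncation.
have QN : approx N.+1 Q phi.2 by exact: approx_truncation.
set F := P.[S]; pose G := Q.[S].
(* Since [phi.2] has no linear term in [z], the linear coefficient of its restriction [G] is
   [phi.2 0 1], without a contribution of the slope of [S]. *)
have approxG : approx 2 Q (ps_mono (phi.2 0%N 1%N) 0 1).
  by move=> [|[|m]] [|[|n]] //= mn; rewrite QN //=; lia.
have GE d : (d < 2)%N -> G`_d = (phi.2 0%N 1%N *: 'X)`_d.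
  move=> d2; rewrite /G (approx_horner S0 approxG (@approx_mono _ 2 _ 0 1) d2).
  by rewrite expr0 mulr1 hornerC expr1.
have G0 : G`_0 = 0 by rewrite GE // coefZ coefX mulr0.
have G1 : G`_1 = phi.2 0%N 1%N by rewrite GE // coefZ coefX mulr1.
pose H := \sum_(l < N) Y 1%N l *: G ^+ l.
have HE := coef_series_leading kN G0 Ylt.
apply: (@leading_coef_ode_eq0 _ k N F H) => [e eN|j jk|]; last first.
- by rewrite HE // eqxx G1 mulf_neq0 // expf_neq0.
- by rewrite (HE _ (ltnW jk)) ltn_eqF.
pose A := (1 *: 'X^(k.+1))%:P * 'X^0 + (I *: 'X^k)%:P * 'X^1 : {poly {poly K}}.
pose B := (1 *: 'X^(k.+2))%:P * 'X^0 : {poly {poly K}}.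
have approxL : approx N (A * P^`() + B * map_poly (@deriv K) P) (ps_comp Y phi).
  rewrite -HY; apply: approxD; apply: approxM.
  - by apply: approxD; exact: approx_mono.
  - exact: approx_dz.
  - exact: approx_mono.
  - exact: approx_dw.
have approxR := approx_comp Y phi1 phi2 (approxW (leqnSn N) PN) (approxW (leqnSn N) QN).
have := approx_horner S0 approxL approxR eN.
have -> : (\sum_(i < N) \sum_(j < N) (Y i j)%:P%:P * (P ^+ i * Q ^+ j)).[S] = F * H.
  rewrite horner_sum (bigD1 (Ordinal N1)) //= [X in _ + X]big1 => [|i i1]; last first.
    rewrite horner_sum big1 // => j _.
    by rewrite Yn1 ?polyC0 ?mul0r ?horner0.
  rewrite addr0 horner_sum mulr_sumr; apply: eq_bigr => j _.
  by rewrite expr1 !hornerM hornerC horner_exp mul_polyC scalerAr.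
move=> <-.
(* By the chain rule, the restricted derivation differs from [w^(k+2) F'] by a multiple of the
   defect of [S] in its differential equation, which has no term below degree [N]. *)
have -> : (A * P^`() + B * map_poly (@deriv K) P).[S] =
    'X^(k.+2) * F^`() + 'X^k * (P^`().[S] * ('X + I *: S - 'X^2 * S^`())).
  rewrite /F deriv_horner /A /B !hornerE /= !scale1r -!mul_polyC !exprS expr0; ring.
rewrite coefD [X in _ + X](_ : _ = 0) ?addr0 //.
rewrite coefXnM; case: ifP => // _; rewrite coefM big1 // => j _.
by rewrite (center_poly_ode) ?mulr0 //; have := ltn_ord j; lia.
Qed.

End CenterManifold.

(** * Sums of factorials *)

Lemma leq_mul_factS a b : (a.+1`! * b.+1`! <= (a + b).+1`!)%N.
Proof.
elim: a => [|a IH]; first by rewrite mul1n.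
rewrite addSn factS -mulnA [leqRHS]factS; apply: leq_mul => //.
by rewrite !ltnS leq_addr.
Qed.

(* The two extreme terms are [n!] and the [n - 1] others are at most [(n - 1)!]. *)
Lemma leq_sum_mul_fact n : (\sum_(j < n.+1) j`! * (n - j)`! <= 3 * n`!)%N.
Proof.
case: n => [|n]; first by rewrite big_ord1.
rewrite big_ord_recl big_ord_recr /= subn0 subnn mul1n muln1.
have : (\sum_(i < n) (bump 0 i)`! * (n.+1 - bump 0 i)`! <= \sum_(i < n) n`!)%N.
  apply: leq_sum => i _; rewrite /bump /= add1n subSS.
  have := ltn_ord i => lt_in.
  have -> : (n - i = (n - i.+1).+1)%N by lia.
  apply: leq_trans (leq_mul_factS _ _) _.
  by have -> : (i + (n - i.+1)).+1 = n by lia.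
rewrite sum_nat_const card_ord => H.
rewrite (mulnDl 1 2) mul1n leq_add2l (mulnDl 1 1) mul1n leq_add2r.
apply: leq_trans H _; rewrite factS leq_mul2r; apply/orP; right; exact: leqnSn.
Qed.

(** Splitting off [p = 2] gives [U (d+1) = B U d + B^2 (d+1)!]. Once [d + 1] is at least [2 B], each
    summand is at most half of [c (d+1)!]. *)
Lemma fact_tail_sum_bound B :
  exists c, forall d, (\sum_(2 <= p < d.+3) B ^ p * (d.+2 - p)`! <= c * d`!)%N.
Proof.
pose U d := (\sum_(2 <= p < d.+3) B ^ p * (d.+2 - p)`!)%N.
have US d : U d.+1 = (B * U d + B ^ 2 * d.+1`!)%N.
  rewrite /U big_nat_recl // big_distrr /= addnC subnS /= ; congr addn.
  rewrite [RHS]big_nat_cond [LHS]big_nat_cond; apply: eq_bigr => p _.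
  by rewrite expnS mulnA subSS.
(* The sum covers the finitely many small indices; [2 * B ^ 2] pays for the term [B^2 (d+1)!] of the
   recurrence. *)
exists (\sum_(e < (2 * B).+2) U e + 2 * B ^ 2)%N => d.
rewrite -/(U d); elim: d => [|d IH].
  by rewrite big_ord_recl muln1 -addnA leq_addr.
have [lt_d|le_d] := ltnP d.+1 (2 * B).+2.
  rewrite (bigD1 (Ordinal lt_d)) //= -addnA.
  by rewrite mulnDl; apply: leq_trans (leq_addr _ _); rewrite leq_pmulr // fact_gt0.
rewrite US; move: IH; set c := (X in (_ <= X * _)%N) => IH.
have cB : (2 * B ^ 2 <= c)%N by rewrite leq_addl.
rewrite factS.
have H1 : (2 * (B * U d) <= c * (d.+1 * d`!))%N.
  apply: (@leq_trans (2 * B * (c * d`!))%N); first by rewrite -mulnA !leq_mul2l IH !orbT.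
  rewrite mulnCA leq_mul2l leq_mul2r; apply/orP; right; apply/orP; right; lia.
have H2 : (2 * B ^ 2 * (d.+1 * d`!) <= c * (d.+1 * d`!))%N by rewrite leq_mul2r cB orbT.
by move: H1 H2; set x := (d.+1 * _)%N; rewrite -mulnA; lia.
Qed.

(* The tail sum is of the order of [d!], that is, [1 / d] times the left-hand side. *)
Lemma fact_not_tail_bounded B L :
  ~ forall d, (d.+1`! <= L * \sum_(2 <= p < d.+3) B ^ p * (d.+2 - p)`!)%N.
Proof.
move=> H; have [c cP] := fact_tail_sum_bound B.
(* At [d = L * c], dividing by [d!] leaves [d + 1 <= d]. *)
have := leq_trans (H (L * c)%N) (leq_mul (leqnn L) (cP _)).
by rewrite factS mulnA leq_pmul2r ?fact_gt0 // ltnn.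
Qed.

(** * Growth of the coefficients along the center manifold *)

Section Estimates.
Context {K : numFieldType} (I : K).
Hypothesis I2 : I ^+ 2 = -1.

Lemma norm_center_coefS n : `|center_coef I n.+1| = n`!%:R.
Proof.
have nI : `|I| = 1.
  by apply/eqP; rewrite -(@pexpr_eq1 _ _ 2) // -normrX I2 normrN1.
by rewrite !normrM normrX normrN nI expr1n !mul1r normr_nat.
Qed.

Lemma norm_center_poly_le N j : `|(center_poly I N)`_j.+1| <= j`!%:R.
Proof.
by rewrite coef_poly; case: ifP => _; rewrite ?norm_center_coefS // normr0 ler0n.
Qed.

Lemma center_polyX_lt N m e : (e < m)%N -> (center_poly I N ^+ m)`_e = 0.
Proof.
have [T ->] := poly_eqMX (center_poly0 I N).
by move=> em; rewrite exprMn coefMXn em.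
Qed.

(** Each further factor [S] convolves factorials with factorials, which by [leq_sum_mul_fact] costs
    only a factor 3. *)
Lemma norm_center_polyX_le N m e :
  `|(center_poly I N ^+ m)`_(m + e)| <= (3 ^ m * e`!)%:R.
Proof.
elim: m e => [|m IH] e.
  rewrite expr0 coef1 mul1n; case: e => [|e]; rewrite ?normr1 ?normr0 ?ler0n //.
rewrite exprS coefM addSn big_ord_recl center_poly0 mul0r add0r.
rewrite (@sum_ord_widen0 _ e.+1 (m + e).+1
  (fun j => (center_poly I N)`_j.+1 * (center_poly I N ^+ m)`_(m + e - j))); last first.
- by move=> j /andP[ej jN]; rewrite center_polyX_lt ?mulr0 //; lia.
- by rewrite ltnS leq_addl.
apply: le_trans (ler_norm_sum _ _ _) _.
apply: (@le_trans _ _ (\sum_(j < e.+1) (3 ^ m * (j`! * (e - j)`!))%:R)).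
  apply: ler_sum => j _; rewrite normrM mulnCA natrM; apply: ler_pM => //.
    exact: norm_center_poly_le.
  have -> : (m + e - j = m + (e - j))%N by have := ltn_ord j; lia.
  exact: IH.
rewrite -natr_sum ler_nat -big_distrr /= expnSr -mulnA leq_mul2l.
by rewrite leq_sum_mul_fact orbT.
Qed.

Lemma coef_truncation_horner (f : series2 K) S N d :
  (truncation N f).[S]`_d = \sum_(p < N) \sum_(m < p.+1)
    f m (p - m)%N * (if (d < p - m)%N then 0 else (S ^+ m)`_(d - (p - m))).
Proof.
rewrite /truncation horner_sum coef_sum; apply: eq_bigr => p _.
rewrite horner_sum coef_sum; apply: eq_bigr => m _.
by rewrite !hornerE -scalerAl coefZ coefXnM.
Qed.

(* On the center manifold, the coefficient [f 1 0 * s_d] must cancel terms that a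
   geometric bound on [f] makes smaller than [|s_d| = (d - 1)!] by a factor of order [d]. *)
Lemma not_geometric_vanishing_on_center (f : series2 K) (C : nat) (M B L : nat) :
    f 0%N 0%N = 0 -> 1 <= L%:R * `|f 1%N 0%N| ->
    (forall m n, `|f m n| <= (M * B ^ (m + n))%:R) ->
  ~ (forall N d, (d + C < N)%N -> (truncation N.+1 f).[center_poly I N]`_d = 0).
Proof.
move=> f00 f10 fB vanish.
(* In [6 * B], the factor 3 comes from the powers of [S], [B] from the bound on [f], and 2 from
   [p + 1 <= 2^p], which counts the monomials of degree [p]. *)
apply: (@fact_not_tail_bounded (6 * B) (L * M)) => e.
pose d := e.+2; pose N := (d + C).+1; set S := center_poly I N.
have := vanish N d (leqnn _).
rewrite (@approx_horner _ d.+1 _ (truncation d.+1 f) f _ d (center_poly0 I N)) //; last 2 first.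
- by apply: approxW (@approx_truncation _ _ _); rewrite /N; lia.
- exact: approx_truncation.
rewrite coef_truncation_horner.
(* Total degrees 0 and 1 are split off. As [d >= 2], the monomial [w] does not contribute, and
   degree 1 leaves only [f 1 0 * S_d]. *)
rewrite big_ord_recl [X in _ + X]big_ord_recl /= big_ord1.
rewrite [X in _ + (X + _)](_ : _ = f 1%N 0%N * S`_d); last first.
  rewrite big_ord_recl big_ord1 /= expr0 coef1 mulr0 add0r.
  by rewrite /bump /= subnn subn0 expr1.
rewrite /= f00 mul0r add0r.
rewrite /S coef_poly (_ : d < N)%N; last by rewrite /N; lia.
set rest := \sum_(i < e.+1) _ => /eqP; rewrite addr_eq0 => /eqP f10E.
have : `|f 1%N 0%N| * (e.+1)`!%:R <= `|rest|.
  by rewrite -norm_center_coefS -normrM f10E normrN.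
suff restB : `|rest| <= (M * \sum_(2 <= p < e.+3) (6 * B) ^ p * (e.+2 - p)`!)%:R.
  move=> le1; rewrite -(ler_nat K) -mulnA natrM.
  apply: (@le_trans _ _ (L%:R * `|f 1%N 0%N| * e.+1`!%:R)).
    by rewrite -[leLHS]mul1r ler_wpM2r.
  by rewrite -mulrA ler_wpM2l // (le_trans le1).
rewrite big_distrr natr_sum -[2%N]add0n big_addn big_mkord subn2 /=.
apply: le_trans (ler_norm_sum _ _ _) _; apply: ler_sum => i _.
set p := (i + 2)%N.
have pd : (p <= d)%N by rewrite /p /d; have := ltn_ord i; lia.
rewrite /bump /= !add1n.
apply: le_trans (ler_norm_sum _ _ _) _.
apply: (@le_trans _ _ (\sum_(m < p.+1) (M * (3 * B) ^ p * (d - p)`!)%:R)).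
  rewrite /p addn2; apply: ler_sum => m _; rewrite normrM.
  have := ltn_ord m; move: pd; rewrite /p addn2 => pd mp.
  rewrite ltnNge (leq_trans (leq_subr _ _) pd) /=.
  have -> : (d - (i.+2 - m) = m + (d - i.+2))%N by lia.
  apply: le_trans (ler_pM _ _ (fB _ _) (norm_center_polyX_le _ _ _)) _ => //.
  rewrite -natrM ler_nat mulnA leq_mul2r; apply/orP; right.
  rewrite subnKC; last by lia.
  rewrite expnMn -mulnA leq_mul2l mulnC leq_mul2r leq_exp2l //.
  by apply/orP; right; apply/orP; right; lia.
rewrite sumr_const card_ord -mulrnA ler_nat -!mulnA leq_mul2l; apply/orP; right.
rewrite mulnA mulnAC leq_mul2r; apply/orP; right.
rewrite (_ : 6 * B = 2 * (3 * B))%N; last by lia.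
rewrite (expnMn 2) mulnC leq_mul2r.
by apply/orP; right; apply: ltn_expl.
Qed.

End Estimates.

(** * Geometric bounds from convergence *)

Section ComplexSeries.
Context {R : realType}.
Local Open Scope complex_scope.

Lemma norm_normc (x : R[i]) : `|x| = (Normc.normc x)%:C.
Proof. by []. Qed.

Lemma natrC (n : nat) : n%:R = (n%:R : R)%:C :> R[i].
Proof. by rewrite rmorph_nat. Qed.

(** Cauchy estimate at the point [(x, x)] with [x = rho / 2]: each term is at most the absolute sum
    [A], so [M] bounds [A] and [B] bounds [1 / x]. *)
Lemma ps_convergent_geometric (f : series2 R[i]) : ps_convergent f ->
  exists M B : nat, forall m n, `|f m n| <= (M * B ^ (m + n))%:R.
Proof.
case=> rho rho0 conv; pose x : R := rho / 2.
have x0 : 0 < x by rewrite divr_gt0.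
have nx : Normc.normc x%:C = x by rewrite /= expr0n /= addr0 sqrtr_sqr gtr0_norm.
have xrho : Normc.normc x%:C < rho.
  by rewrite nx /x ltr_pdivrMr // ltr_pMr // ltr1n.
have := conv _ _ xrho xrho; rewrite /ps_converges_at /summable.
set A := esum _ _ => Afin.
have termA m n : ((Normc.normc (f m n) * x ^+ (m + n))%:E <= A)%E.
  apply: esum_ge; exists [set (m, n)]%classic; first by split.
  rewrite fsbig_set1 /= lee_fin ger0_norm; last by case: (_ * _) => u v; exact: sqrtr_ge0.
  have nxX e : Normc.normc (x%:C ^+ e) = x ^+ e.
    elim: e => [|e IH]; first by rewrite Normc.normc1.
    by rewrite !exprS Normc.normcM IH nx.
  by rewrite !Normc.normcM !nxX exprD mulrA.
have A0 : (0 <= A)%E by apply: esum_ge0.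
pose a := fine A.
have aE : A = a%:E by rewrite fineK // ge0_fin_numE.
exists (Num.bound a), (Num.bound x^-1) => m n.
rewrite norm_normc natrC lecR natrM natrX.
have a0 : 0 <= a by rewrite fine_ge0.
have ax : Normc.normc (f m n) <= a * x^-1 ^+ (m + n).
  rewrite exprVn ler_pdivlMr ?exprn_gt0 // -lee_fin -aE; exact: termA.
apply: le_trans ax _; apply: ler_pM => //.
- by rewrite exprn_ge0 // invr_ge0 ltW.
- exact: ltW (archi_boundP a0).
- rewrite lerXn2r ?nnegrE ?invr_ge0 ?ler0n ?(ltW x0) //.
  by apply/ltW/archi_boundP; rewrite invr_ge0 ltW.
Qed.

Lemma norm_archi (x : R[i]) : x != 0 -> exists L : nat, 1 <= L%:R * `|x|.
Proof.
move=> x0; have nx : 0 < Normc.normc x by rewrite -ltcR -norm_normc normr_gt0.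
pose L := Num.bound (Normc.normc x)^-1; exists L.
rewrite norm_normc (natrC L) -rmorphM -[1]/(1%:R) (natrC 1) lecR.
by rewrite -ler_pdivrMr // div1r; apply/ltW/archi_boundP; rewrite invr_ge0 ltW.
Qed.

End ComplexSeries.

(** * Shape of the normal form, and the conclusion *)

Section NormalForm.
Context {R : realType}.

Lemma normal_form2_eq0 k q (c : 'I_q -> R[i]) r t i j :
  (0 < k)%N -> (0 < q)%N -> (j < k.+2)%N -> (normal_form k c r t).2 i j = 0.
Proof.
move=> k0 q0 jk; rewrite /normal_form /=.
have lt1 : (j < k + 1 + q)%N by lia.
have lt2 : (j < 2 * q + 2 * k + 1)%N by lia.
by rewrite series2_addE /ps_mono (ltn_eqF lt1) (ltn_eqF lt2) !andbF addr0.
Qed.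

Lemma normal_form1E k q (c : 'I_q -> R[i]) r t i j :
  [/\ i != 1%N -> (normal_form k c r t).1 i j = 0,
      (j < k)%N -> (normal_form k c r t).1 i j = 0 &
      (normal_form k c r t).1 1%N k = 'i%C].
Proof.
rewrite /normal_form /= !ps_mul_mono !subnn !leqnn.
have sumE m n : (\sum_(j < q) ps_mono (c j) 0 j.+1) m n = \sum_(j < q) ps_mono (c j) 0 j.+1 m n.
  by rewrite !fct_sumE.
split => [i1|jk|].
- case: ifP => // /andP[i0 _]; rewrite /= [X in _ * X](_ : _ = 0) ?mulr0 //.
  have /negPf ij0 : (i - 1 != 0)%N by lia.
  by rewrite series2_addE sumE /ps_mono ij0 add0r; apply: big1.
- by rewrite (leqNgt k) jk andbF.
- by rewrite /= series2_addE sumE big1 ?addr0 // /ps_mono /= mulr1.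
Qed.

End NormalForm.

Theorem theorem5 (R : realType) (k : nat) (hk : (0 < k)%N)
    (phi : (nat -> nat -> R[i]) * (nat -> nat -> R[i]))
    (hphi : formal_transformation phi)
    (q : nat) (hq : (1 <= q)%N) (c : 'I_q -> R[i]) (r t : R[i])
    (hnf : brings_to phi (X_field k) (normal_form k c r t)) :
  divergent phi.
Proof.
have I2 : 'i%C ^+ 2 = -1 :> R[i] by exact: sqr_i.
have I0 : 'i%C != 0 :> R[i].
  by apply/eqP => I0; move/eqP: I2; rewrite I0 expr0n /= eq_sym oppr_eq0 oner_eq0.
case: hphi => f00 g00 lin; case: hnf => hX1 hX2.
(* The coefficient of [z w^k] in the second conjugacy equation is compared. On the left it is
   [i * phi.2 1 0]; on the right it is zero, because the second component of the normal form is
   divisible by [w^(k+2)]. *)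
have g10 : phi.2 1%N 0%N = 0.
  have := congr1 (fun h : series2 R[i] => h 1%N k) hX2.
  rewrite /vf_apply /ps_comp [RHS]big1 => [|i _]; last first.
    by apply: big1 => j _; rewrite normal_form2_eq0 ?mul0r.
  have k2 : (k.+2 <= k)%N = false by lia.
  rewrite series2_addE ps_mulDl !ps_mul_mono leqnn ltnn k2 !andbF.
  rewrite leqnn !subnn add0r addr0.
  move/eqP; rewrite mulf_eq0 (negPf I0) => /eqP.
  by rewrite /ps_dz mulr1n.
(* By [g10] the linear part is upper triangular, so its invertibility makes both diagonal entries
   nonzero; the transpose is taken because [det_trig] concerns lower triangular matrices. *)
have [f10 g01] : phi.1 1%N 0%N != 0 /\ phi.2 0%N 1%N != 0.
  move: lin; rewrite unitmxE -det_tr det_trig; last first.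
    by apply/is_trig_mxP => -[[|[|i]] ?] [[|[|j]] ?] //= _; rewrite !mxE.
  by rewrite !big_ord_recl big_ord0 mulr1 !mxE unitfE mulf_eq0 negb_or => /andP.
have vanish := invariant_on_center I2 hk f00 g00 g10 g01 _ _ _ hX1.
case=> /ps_convergent_geometric [M [B fB]] _.
have [L fL] := norm_archi f10.
apply: (not_geometric_vanishing_on_center I2 f00 fL fB (C := k)).
apply: vanish => [i j|j|].
- by case: (normal_form1E k c r t i j).
- by case: (normal_form1E k c r t 1 j).
- by case: (normal_form1E k c r t 0 0) => _ _ ->.
Qed.
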